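(* There are infinitely many integer triples $(a,b,c)$ with $0<a+1<b<c$, $c-a$ even, and $$(a+1)^2+(a+2)^2+\cdots+b^2=(b+1)^2+(b+2)^2+\cdots+c^2 .$$ *)

(* Defs.v *)
From HB Require Import structures.
From mathcomp Require Import all_boot all_order all_algebra.

Set Implicit Arguments.
Unset Strict Implicit.
Unset Printing Implicit Defensive.

Import Order.TTheory GRing.Theory Num.Theory.
Local Open Scope ring_scope.

(* (m+1)^2 + (m+2)^2 + ... + n^2 for integers m <= n, a sum of n - m terms;
   the absolute value only converts n - m to nat, and the value for n < m is
   irrelevant. *)
Definition sum_sqr (m n : int) : int :=
  \sum_(1 <= i < `|n - m|%N.+1) (m + i%:Z) ^+ 2.

(* Main.v *)
(* Put X = 2a+1, Y = 2b+1, Z = 2c+1; the equation becomes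
   X^3 + Z^3 - 2 Y^3 = X + Z - 2 Y.  Searching for solutions on the lines
   X, Z = 75 d -+ 52 w, Y = 101 d reduces it to the Pell equation
   23401 d^2 - 23400 w^2 = 1, which has the solution d = w = 1.
   Multiplication by the unit 46801 + 2 sqrt (23400 * 23401) yields infinitely
   many others, and preserves the oddness of d and w. *)
Require Import Defs.
From HB Require Import structures.
From mathcomp Require Import all_boot all_order all_algebra.
From mathcomp Require Import classical_sets cardinality.
From mathcomp Require Import ring zify.

Set Implicit Arguments.
Unset Strict Implicit.
Unset Printing Implicit Defensive.

Import Order.TTheory GRing.Theory Num.Theory.
Local Open Scope classical_set_scope.
Local Open Scope ring_scope.

Lemma sum_sqr_closed (m n : int) : m <= n ->
  6 * sum_sqr m n = n * (n + 1) * (2 * n + 1) - m * (m + 1) * (2 * m + 1).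
Proof.
move=> le_mn; rewrite /sum_sqr.
have [k ->] : exists k : nat, n = m + k by exists `|n - m|%N; lia.
have -> : `|(m + k : int) - m|%N = k by lia.
elim: k => [|k IHk]; first by rewrite big_geq //; ring.
by rewrite big_nat_recr //= mulrDr IHk intS; ring.
Qed.

(* [(s, t)] stands for the solution [d = 2 s + 1], [w = 2 t + 1] of
   [(N + 1) d^2 - N w^2 = 1], and the step is multiplication by the unit
   [2 N + 1 + 2 sqrt (N (N + 1))]. *)
Definition pell_step (N : int) (st : int * int) : int * int :=
  ((2 * N + 1) * st.1 + 2 * N * st.2 + 2 * N,
   (2 * N + 2) * st.1 + (2 * N + 1) * st.2 + 2 * N + 1).

Definition pell (N : int) (k : nat) : int * int := iter k (pell_step N) (0, 0).

(** The equation is the Pell equation with 1 subtracted, divided by 4. The bound on [52 * t] will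
    give [a >= 0], and [s <= t] will give [b < c]. *)
Lemma pellP (N : int) k : 0 < N ->
  [/\ 0 <= (pell N k).1, (pell N k).1 <= (pell N k).2,
      52 * (pell N k).2 <= 75 * (pell N k).1 + 11
    & (N + 1) * ((pell N k).1 ^+ 2 + (pell N k).1) =
      N * ((pell N k).2 ^+ 2 + (pell N k).2)].
Proof.
move=> N_gt0; elim: k => [|k]; first by split=> //=; ring.
rewrite /pell iterS -/(pell N k) /pell_step.
case: (pell N k) => s t /= [s_ge0 le_st le_ts eq_st].
have t_ge0 := le_trans s_ge0 le_st.
split; [nia | nia | nia |].
apply/eqP; rewrite -subr_eq0; apply/eqP.
(* The unit has norm [(2 N + 1)^2 - 4 N (N + 1) = 1], so the step preserves this form. *)
transitivity ((N + 1) * (s ^+ 2 + s) - N * (t ^+ 2 + t)); first by ring.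
by rewrite eq_st subrr.
Qed.

Lemma pell_fst_lt (N : int) k l : 0 < N -> (k < l)%N ->
  (pell N k).1 < (pell N l).1.
Proof.
move=> N_gt0.
apply: (@homo_ltn _ (fun i => (pell N i).1) <%R) => [y x z|i].
  exact: lt_trans.
have [] := pellP i N_gt0; rewrite /pell iterS -/(pell N i) /pell_step /=.
by case: (pell N i) => s t /=; nia.
Qed.

(* 23400, as a product because [23400%:R] unfolds to a unary numeral on which
   the tactics overflow the stack. *)
Definition pell_param : int := 234 * 100.

Lemma pell_param_gt0 : 0 < pell_param.
Proof. by rewrite mulr_gt0. Qed.

Lemma pell_sum_sqr (s t : int) : 0 <= s -> s <= t -> 52 * t <= 75 * s + 11 ->
    (pell_param + 1) * (s ^+ 2 + s) = pell_param * (t ^+ 2 + t) ->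
  sum_sqr (75 * s - 52 * t + 11) (101 * s + 50) =
  sum_sqr (101 * s + 50) (75 * s + 52 * t + 63).
Proof.
move=> s_ge0 le_st le_ts eq_st.
apply: (@mulfI _ 6) => //; rewrite !sum_sqr_closed; [|lia|lia].
apply/eqP; rewrite -subr_eq0; apply/eqP.
(* Here [2 (75^3 - 101^3) = - 52 * 23401] and [6 * 75 * 52^2 = 52 * 23400]. *)
transitivity (52 * (2 * s + 1) *
  ((pell_param + 1) * (s ^+ 2 + s) - pell_param * (t ^+ 2 + t))).
  by rewrite /pell_param; ring.
by rewrite eq_st subrr mulr0.
Qed.

Theorem theorem1p4 :
  infinite_set [set t : int * int * int |
    let: (a, b, c) := t in
    [/\ 0 < a + 1, a + 1 < b, b < c, (2 %| c - a)%Z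
      & sum_sqr a b = sum_sqr b c]].
Proof.
pose triple (st : int * int) : int * int * int :=
  (75 * st.1 - 52 * st.2 + 11, 101 * st.1 + 50, 75 * st.1 + 52 * st.2 + 63).
move=> finS; apply: infinite_nat.
have inj : injective (triple \o pell pell_param).
  (* The entry [b] alone determines the index, as [s] strictly increases. *)
  move=> k l [_ eq_b _]; case: (ltngtP k l) => //
    /pell_fst_lt-/(_ _ pell_param_gt0); lia.
apply: sub_finite_set
  (finite_preimage (f := triple \o pell pell_param) _ finS); last first.
  by move=> k l _ _; apply: inj.
move=> k _ /=; have [] := pellP k pell_param_gt0; case: (pell _ k) => s t /=.
move=> s_ge0 le_st le_ts eq_st; split; [lia | lia | lia | | exact: pell_sum_sqr].
by apply/dvdzP; exists (52 * t + 26); ring.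
Qed.
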